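(* A basis $\mathcal{B}$ for a quasi-Banach space $\mathbb{X}$ is suppression unconditional if and only if it is lattice unconditional. Moreover $K_{su}\le K_u$, and if $\mathbb{X}$ is a $p$-Banach space ($0<p\le 1$), then $K_u\le B_p K_{su}$.
   Context: The scalar field $\mathbb{F}$ is $\mathbb{R}$ or $\mathbb{C}$. A quasi-norm on a vector space satisfies the axioms of a norm except that the triangle inequality is replaced by $\Vert f+g\Vert\le\kappa(\Vert f\Vert+\Vert g\Vert)$ for some constant $\kappa\ge 1$; a quasi-Banach space is a vector space complete for the topology of a quasi-norm. It is a $p$-Banach space ($0<p\le1$) if moreover $\Vert f+g\Vert^p\le \Vert f\Vert^p+\Vert g\Vert^p$ for all $f,g$. A basis of $\mathbb{X}$ is a sequence $\mathcal{B}=(\mathbf{x}_n)_{n=1}^\infty$ whose closed linear span is $\mathbb{X}$ and for which there is a (unique) sequence $(\mathbf{x}_n^* )_{n=1}^\infty$ in $\mathbb{X}^*$ with $\mathbf{x}_n^*(\mathbf{x}_k)=\delta_{k,n}$ for all $k,n$. For $\gamma=(c_n)_{n=1}^\infty\in\mathbb{F}^{\mathbb{N}}$, let $M_\gamma$ be the linear map from the linear span of $(\mathbf{x}_n)_{n=1}^\infty$ into $\mathbb{X}$ given by $\sum_n a_n\mathbf{x}_n\mapsto\sum_n c_na_n\mathbf{x}_n$ (finite sums). It is called well-defined on $\mathbb{X}$ if it is continuous for the topology of $\mathbb{X}$, i.e., extends (uniquely) to a continuous linear map $\mathbb{X}\to\mathbb{X}$, still denoted $M_\gamma$. For $A\subseteq\mathbb{N}$,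 $S_A:=M_{\gamma}$, where $\gamma$ is the indicator sequence of $A$. $\mathcal{B}$ is lattice unconditional if $M_\gamma$ is well-defined for every $\gamma\in\ell_\infty$ and $K_u:=\sup_{\Vert\gamma\Vert_\infty\le1}\Vert M_\gamma\Vert<\infty$. $\mathcal{B}$ is suppression unconditional if $S_A$ is well-defined for every $A\subseteq\mathbb{N}$ and $K_{su}:=\sup_{A\subseteq\mathbb{N}}\Vert S_A\Vert<\infty$. Put $A_p=(2^p-1)^{-1/p}$, and $B_p=2^{1/p}A_p$ if $\mathbb{F}=\mathbb{R}$, $B_p=4^{1/p}A_p$ if $\mathbb{F}=\mathbb{C}$. *)

(* Defs.v *)
From HB Require Import structures.
From mathcomp Require Import all_boot all_order all_algebra.
From mathcomp Require Import complex.
From mathcomp Require Import all_classical all_reals all_analysis.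

Set Implicit Arguments.
Unset Strict Implicit.
Unset Printing Implicit Defensive.

Import Order.TTheory GRing.Theory Num.Theory.
Import numFieldNormedType.Exports.

Local Open Scope classical_set_scope.
Local Open Scope ring_scope.

Variant scalars := RealScalars | ComplexScalars.

Definition scalar_field (R : realType) (s : scalars) : numFieldType :=
  match s with
  | RealScalars => R
  | ComplexScalars => complex R
  end.

(* `|z| lives in the scalar field itself; modulus is its R-valued version. *)
Definition modulus (R : realType) (s : scalars) : scalar_field R s -> R :=
  match s return scalar_field R s -> R with
  | RealScalars => fun a => `|a|
  | ComplexScalars => fun z => complex.Re `|z|
  end.
Arguments modulus {R s}.

Section QuasiBanach.
Variables (R : realType) (s : scalars).
Local Notation F := (scalar_field R s).
Variable X : PreUniformLmodule.type F.

Record quasi_norm (q : X -> R) : Prop := QuasiNorm {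
  qnorm_ge0 : forall f, 0 <= q f ;
  qnorm_eq0 : forall f, q f = 0 -> f = 0 ;
  qnormZ : forall (a : F) f, q (a *: f) = modulus a * q f ;
  qnorm_triangle : exists2 kappa : R, 1 <= kappa &
    forall f g, q (f + g) <= kappa * (q f + q g)
}.

(* X carries an a priori unrelated uniform structure: the second field says
   that it is the translation-invariant one induced by q. *)
Record quasi_banach (q : X -> R) : Prop := QuasiBanach {
  qbanach_norm : quasi_norm q ;
  qbanach_entourage : @entourage X =
    filter_from [set e : R | 0 < e]
      (fun e => [set fg : X * X | q (fg.1 - fg.2) < e]) ;
  qbanach_complete : forall G : set_system X, ProperFilter G -> cauchy G ->
    exists f : X, G --> f
}.

Definition p_banach (q : X -> R) (p : R) : Prop :=
  quasi_banach q /\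
  forall f g, q (f + g) `^ p <= q f `^ p + q g `^ p.

Definition linear_span (x : nat -> X) : set X :=
  [set f | exists n (a : nat -> F), f = \sum_(0 <= i < n) a i *: x i].

Definition is_basis (x : nat -> X) : Prop :=
  closure (linear_span x) = setT /\
  exists xs : nat -> {scalar X},
    (forall n, continuous (xs n : X -> F)) /\
    (forall n k, xs n (x k) = (k == n)%:R).

(* T is the continuous linear extension to X of M_gamma. *)
Definition multiplier (x : nat -> X) (gamma : nat -> F)
    (T : {linear X -> X}) : Prop :=
  continuous T /\
  forall n (a : nat -> F), T (\sum_(0 <= i < n) a i *: x i) =
                           \sum_(0 <= i < n) (gamma i * a i) *: x i.

Definition well_defined (x : nat -> X) (gamma : nat -> F) : Prop :=
  exists T, multiplier x gamma T.

Definition operator_norm (q : X -> R) (T : X -> X) : \bar R :=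
  ereal_sup [set (q (T f))%:E | f in [set f | q f <= 1]].

(* On a basis the extension T is unique, so the infimum is the operator norm of
   M_gamma if M_gamma is well-defined, and +oo (the infimum of the empty set)
   otherwise. *)
Definition multiplier_norm (q : X -> R) (x : nat -> X) (gamma : nat -> F)
    : \bar R :=
  ereal_inf [set operator_norm q T | T in multiplier x gamma].

Definition K_u (q : X -> R) (x : nat -> X) : \bar R :=
  ereal_sup [set multiplier_norm q x gamma |
             gamma in [set gamma | forall n, modulus (gamma n) <= 1]].

Definition K_su (q : X -> R) (x : nat -> X) : \bar R :=
  ereal_sup [set multiplier_norm q x (\1_A) | A in [set: set nat]].

Definition lattice_unconditional (q : X -> R) (x : nat -> X) : Prop :=
  (forall gamma : nat -> F, (exists M : R, forall n, modulus (gamma n) <= M) ->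
     well_defined x gamma) /\
  (K_u q x < +oo)%E.

Definition suppression_unconditional (q : X -> R) (x : nat -> X) : Prop :=
  (forall A : set nat, well_defined x (\1_A)) /\ (K_su q x < +oo)%E.

End QuasiBanach.

Definition A_const (R : realType) (p : R) : R := (2 `^ p - 1) `^ (- p^-1).

Definition B_const (R : realType) (s : scalars) (p : R) : R :=
  match s with
  | RealScalars => 2 `^ p^-1 * A_const p
  | ComplexScalars => 4 `^ p^-1 * A_const p
  end.

(* Main.v *)
(* A sequence r with values in [0,1] satisfies r = 1/2 1_A + 1/2 r', where
   A = {r >= 1/2} and r' again has values in [0,1].  In a p-Banach space this
   makes the supremum s of q(M_r f)^p over all such r, which is finite for a
   finite combination f, satisfy s <= 2^-p (K_su q(f))^p + 2^-p s, that is
   s <= (A_p K_su q(f))^p.  A general scalar sequence bounded by 1 is a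
   combination with unimodular coefficients of 2 (real case) or 4 (complex case)
   such sequences.  For a quasi-norm of modulus kappa the factor 1/2 need not
   absorb kappa; one extracts instead k binary digits at once, with
   kappa 2^-k <= 1/2, so no equivalent p-norm is needed.  The bound on the span
   extends to X because, by completeness, the closure of the graph of M_gamma is
   the graph of a bounded operator. *)
Require Import Defs.
From HB Require Import structures.
From mathcomp Require Import all_boot all_order all_algebra.
From mathcomp Require Import complex.
From mathcomp Require Import all_classical all_reals all_analysis.
From mathcomp Require Import ring lra.

Set Implicit Arguments.
Unset Strict Implicit.
Unset Printing Implicit Defensive.

Import Order.TTheory GRing.Theory Num.Theory.
Local Open Scope classical_set_scope.
Local Open Scope ring_scope.

(** * Real and complex scalars treated uniformly *)

Section Scalars.
Variables (R : realType) (s : scalars).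
Local Notation F := (scalar_field R s).

Definition of_real : R -> F :=
  match s return R -> scalar_field R s with
  | RealScalars => fun r => r
  | ComplexScalars => fun r => real_complex R r
  end.

Lemma of_realD (a b : R) : of_real (a + b) = of_real a + of_real b.
Proof. by rewrite /of_real; case: s => //; rewrite rmorphD. Qed.

Lemma of_realM (a b : R) : of_real (a * b) = of_real a * of_real b.
Proof. by rewrite /of_real; case: s => //; rewrite rmorphM. Qed.

Lemma of_real_bool (b : bool) : of_real b%:R = b%:R.
Proof. by rewrite /of_real; case: s => //; rewrite rmorph_nat. Qed.

Lemma of_real0 : of_real 0 = 0.
Proof. exact: of_real_bool false. Qed.

Lemma of_real1 : of_real 1 = 1.
Proof. exact: of_real_bool true. Qed.

Lemma modulus_ge0 (a : F) : 0 <= modulus a.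
Proof.
case: s a => a; rewrite /modulus; first exact: normr_ge0.
by rewrite (@normc_def R) sqrtr_ge0.
Qed.

Lemma modulusM (a b : F) : modulus (a * b) = modulus a * modulus b.
Proof.
have complexM (y z : complex R) :
    complex.Re `|y * z| = complex.Re `|y| * complex.Re `|z|.
  by rewrite normrM !normc_def -rmorphM.
by case: s a b => a b; [exact: normrM | exact: complexM].
Qed.

Lemma modulus_of_real (r : R) : modulus (of_real r) = `|r|.
Proof.
rewrite /modulus /of_real; case: s => //.
by rewrite (@normc_def R) /= expr0n addr0 sqrtr_sqr.
Qed.

Lemma modulusN1 : modulus (-1 : F) = 1.
Proof. by rewrite /modulus; case: s; rewrite normrN1. Qed.

Definition nparts : nat := if s is RealScalars then 2 else 4.

(** The units are 1, -1 and, in the complex case, i, -i; the coefficients are the positive and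
    negative parts of the real and imaginary parts of [c]. The units come before [c], so the same
    ones serve for all entries of a scalar sequence. *)
Lemma scalar_parts : exists u : nat -> F, (forall k, modulus (u k) = 1) /\
  forall c : F, modulus c <= 1 -> exists r : nat -> R,
    (forall k, 0 <= r k <= 1) /\
    c = \sum_(0 <= k < nparts) u k * of_real (r k).
Proof.
have parts (a : R) : `|a| <= 1 -> [/\ 0 <= Num.max a 0 <= 1,
    0 <= Num.max (- a) 0 <= 1 & a = Num.max a 0 - Num.max (- a) 0].
  rewrite ler_norml => /andP[a1 a2].
  by case: (leP a 0) => ?; case: (leP (- a) 0) => ?; split; lra.
rewrite /nparts /of_real /modulus; case: s => /=.
- exists (fun k => if k is 0%N then 1 else -1); split.
    by case=> [|k]; rewrite ?normrN1 ?normr1.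
  move=> c /parts[h1 h2 h3].
  exists (fun k => if k is 0%N then Num.max c 0 else Num.max (- c) 0).
  split; first by case.
  by rewrite !big_nat_recl// big_geq// addr0 mul1r mulN1r.
- exists (fun k => match k with 0%N => 1 | 1%N => -1 | 2%N => 'i%C
    | _ => - 'i%C end); split.
    have i1 : complex.Re `|'i%C : complex R| = 1.
      by rewrite normc_def /= expr0n expr1n add0r sqrtr1.
    have u1 : complex.Re `|1 : complex R| = 1 by rewrite normr1.
    have uN1 : complex.Re `|-1 : complex R| = 1 by rewrite normrN.
    have iN1 : complex.Re `|- 'i%C : complex R| = 1 by rewrite normrN.
    by case=> [|[|[|k]]].
  move=> c hc.
  have cE : complex.Re `|c| ^+ 2 = complex.Re c ^+ 2 + complex.Im c ^+ 2.
    by rewrite normc_def /= sqr_sqrtr// addr_ge0// sqr_ge0.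
  have c1 : complex.Re c ^+ 2 + complex.Im c ^+ 2 <= 1.
    by rewrite -cE expr_le1// normc_def sqrtr_ge0.
  have /parts[a1 a2 a3] : `|complex.Re c| <= 1.
    by rewrite -(@expr_le1 _ 2)// real_normK ?num_real//;
      apply: le_trans c1; rewrite lerDl sqr_ge0.
  have /parts[b1 b2 b3] : `|complex.Im c| <= 1.
    by rewrite -(@expr_le1 _ 2)// real_normK ?num_real//;
      apply: le_trans c1; rewrite lerDr sqr_ge0.
  exists (fun k => match k with
    | 0%N => Num.max (complex.Re c) 0 | 1%N => Num.max (- complex.Re c) 0
    | 2%N => Num.max (complex.Im c) 0 | _ => Num.max (- complex.Im c) 0 end).
  split; first by case=> [|[|[|k]]].
  rewrite !big_nat_recl// big_geq//.
  apply/eqP; rewrite eq_complex /=; apply/andP; split; apply/eqP.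
    by rewrite [LHS]a3; ring.
  by rewrite [LHS]b3; ring.
Qed.

End Scalars.
Arguments of_real {R} s.

(** * Self-improving bounds and the binary splitting *)

Lemma powR2_gt1 (R : realType) (p : R) : 0 < p -> 1 < 2 `^ p.
Proof.
move=> p0; have : 1 `^ p < 2 `^ p :> R by rewrite gt0_ltr_powR ?nnegrE//; lra.
by rewrite powR1.
Qed.

(** If sigma is the supremum of [phi] on [S], the step hypothesis yields sigma <= a + theta * sigma,
    which is then solved for sigma. The bound [D] makes sigma finite; it may be arbitrarily crude,
    because it disappears from the conclusion. *)
Lemma affine_recursion_bound (R : realType) (T : Type) (S : set T) (phi : T -> R)
    (a theta D : R) : 0 <= theta < 1 -> (forall t, S t -> phi t <= D) ->
  (forall t, S t -> exists2 t', S t' & phi t <= a + theta * phi t') ->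
  forall t, S t -> phi t <= a / (1 - theta).
Proof.
move=> /andP[th0 th1] phiD step t St.
have sub t' : S t' -> phi t' <= sup (phi @` S).
  move=> St'; apply: ub_le_sup; last by exists t'.
  by exists D => _ [t'' St'' <-]; exact: phiD.
have supP : sup (phi @` S) <= a + theta * sup (phi @` S).
  apply: ge_sup; first by exists (phi t); exists t.
  move=> _ [t' /step[t'' St'' le] <-]; apply: le_trans le _.
  by rewrite lerD2l ler_wpM2l// sub.
apply: le_trans (sub _ St) _.
by rewrite ler_pdivlMr ?subr_gt0//; lra.
Qed.

Lemma binary_step (R : realType) (r : nat -> R) : (forall i, 0 <= r i <= 1) ->
  exists A : set nat, exists2 r' : nat -> R, (forall i, 0 <= r' i <= 1) &
    forall i, r i = 2^-1 * (i \in A)%:R + 2^-1 * r' i.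
Proof.
move=> r01; pose A := [set i | 2^-1 <= r i].
exists A, (fun i => 2 * r i - (i \in A)%:R) => i; last by field.
have /andP[r0 r1] := r01 i.
by have [/set_mem|/negP nA] := boolP (i \in A); rewrite /A /=;
  [|have : ~ 2^-1 <= r i by move=> ?; apply: nA; exact: mem_set];
  move=> hr; apply/andP; split; lra.
Qed.

(** * Finite combinations of the vectors [x i] *)

Section Combinations.
Variables (R : realType) (s : scalars).
Local Notation F := (scalar_field R s).
Variables (X : PreUniformLmodule.type F) (x : nat -> X).

Definition comb (n : nat) (a : nat -> F) : X := \sum_(0 <= i < n) a i *: x i.

Lemma combD n a b : comb n (fun i => a i + b i) = comb n a + comb n b.
Proof. by rewrite /comb -big_split/=; apply: eq_bigr => i _; rewrite scalerDl. Qed.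

Lemma combZ n c a : comb n (fun i => c * a i) = c *: comb n a.
Proof. by rewrite /comb scaler_sumr; apply: eq_bigr => i _; rewrite scalerA. Qed.

Lemma eq_comb n a b : a =1 b -> comb n a = comb n b.
Proof. by move=> ab; apply: eq_bigr => i _; rewrite ab. Qed.

Lemma comb_widen n m a : (n <= m)%N ->
  comb n a = comb m (fun i => (i < n)%:R * a i).
Proof.
move=> nm; rewrite /comb (@big_cat_nat _ _ _ n 0 m)//= [X in _ + X]big_nat_cond.
rewrite [X in _ + X]big1 ?addr0; last first.
  by move=> i /andP[/andP[ni _] _]; rewrite ltnNge ni mul0r scale0r.
by apply: eq_big_nat => i /andP[_ ->]; rewrite mul1r.
Qed.

Lemma comb_parts (gamma : nat -> F) : (forall i, modulus (gamma i) <= 1) ->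
  exists (u : nat -> F) (r : nat -> nat -> R),
  [/\ forall k, modulus (u k) = 1, forall k i, 0 <= r k i <= 1 &
    forall n a, comb n (fun i => gamma i * a i) =
      \sum_(0 <= k < nparts s)
        u k *: comb n (fun i => of_real s (r k i) * a i)].
Proof.
move=> gamma1; have [u [u1 parts]] := scalar_parts R s.
have /choice[r rP] : forall i, exists r : nat -> R,
    (forall k, 0 <= r k <= 1) /\
    gamma i = \sum_(0 <= k < nparts s) u k * of_real s (r k).
  by move=> i; exact: parts.
exists u, (fun k i => r i k); split => // [k i|n a]; first by have [+ _] := rP i.
under [RHS]eq_bigr do rewrite -combZ.
rewrite /comb exchange_big/=; apply: eq_bigr => i _.
have [_ ->] := rP i; rewrite -scaler_suml; congr (_ *: _).
by rewrite mulr_suml; apply: eq_bigr => k _; rewrite mulrA.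
Qed.

End Combinations.

(** * Bounds for multipliers on the linear span *)

Section QuasiNormBounds.
Variables (R : realType) (s : scalars).
Local Notation F := (scalar_field R s).
Variables (X : PreUniformLmodule.type F) (q : X -> R) (x : nat -> X).
Hypothesis hq : quasi_norm q.

Lemma qnorm0 : q 0 = 0.
Proof.
by rewrite -(scale0r 0) (qnormZ hq) -of_real0 modulus_of_real
  normr0 mul0r.
Qed.

Lemma qnormN f : q (- f) = q f.
Proof. by rewrite -scaleN1r (qnormZ hq) modulusN1 mul1r. Qed.

Lemma qnormZ_real r f : 0 <= r -> q (of_real s r *: f) = r * q f.
Proof. by move=> r0; rewrite (qnormZ hq) modulus_of_real ger0_norm. Qed.

(** Iterating the quasi-triangle inequality gives c_0 = 0 and c_(m+1) = kappa * (c_m + 1); the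
    constant depends on the number of terms only. *)
Lemma qnorm_sum m : exists2 c : R, 0 <= c &
  forall (v : nat -> X) D, 0 <= D -> (forall k, (k < m)%N -> q (v k) <= D) ->
  q (\sum_(0 <= k < m) v k) <= c * D.
Proof.
have [kappa kappa1 tri] := qnorm_triangle hq.
elim: m => [|m [c c0 IH]].
  by exists 0 => // v D _ _; rewrite big_geq// qnorm0 mul0r.
exists (kappa * (c + 1)) => [|v D D0 vD]; first by rewrite mulr_ge0; lra.
rewrite big_nat_recr//= -mulrA; apply: le_trans (tri _ _) _.
rewrite ler_wpM2l ?mulrDl ?mul1r ?lerD ?vD//; first lra.
by apply: IH => // k km; rewrite vD// ltnW.
Qed.

(** Every term is at most q (a_i x_i), whatever [r] is. This crude bound, depending on [n] and [a],
    provides the finiteness required by [affine_recursion_bound]. *)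
Lemma comb_bounded n a : exists D : R, forall r : nat -> R,
  (forall i, 0 <= r i <= 1) -> q (comb x n (fun i => of_real s (r i) * a i)) <= D.
Proof.
have [c c0 cP] := qnorm_sum n.
exists (c * \sum_(0 <= i < n) q (a i *: x i)) => r r01; apply: cP.
  by apply: sumr_ge0 => i _; exact: qnorm_ge0.
move=> k kn; have /andP[r0 r1] := r01 k.
rewrite -scalerA qnormZ_real//.
rewrite (bigD1_seq k) ?mem_index_iota ?iota_uniq//=.
rewrite -[X in X <= _]addr0 lerD ?sumr_ge0//; last first.
  by move=> i _; exact: qnorm_ge0.
by rewrite ler_piMl// qnorm_ge0.
Qed.

Lemma comb_binary_step (r : nat -> R) : (forall i, 0 <= r i <= 1) ->
  exists A : set nat, exists2 r' : nat -> R, (forall i, 0 <= r' i <= 1) &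
    forall n a, comb x n (fun i => of_real s (r i) * a i) =
      of_real s 2^-1 *: comb x n (fun i => \1_A i * a i) +
      of_real s 2^-1 *: comb x n (fun i => of_real s (r' i) * a i).
Proof.
move=> /binary_step[A [r' r'01 rE]]; exists A, r' => // n a.
rewrite -!combZ -combD; apply: eq_comb => i.
by rewrite rE of_realD !of_realM of_real_bool indicE mulrDl !mulrA.
Qed.

Variable K : R.
Hypothesis K0 : 0 <= K.
Hypothesis hK : forall (A : set nat) n a,
  q (comb x n (fun i => \1_A i * a i)) <= K * q (comb x n a).

(** The first [k] digits are collected in [g]. The powers of kappa produced by the triangle
    inequality all go into [C], while the remainder keeps the clean factor 2^-k because it is
    carried along by an identity, not by an estimate. *)
Lemma comb_binary_digits k : exists2 C : R, 0 <= C &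
  forall (r : nat -> R) n a, (forall i, 0 <= r i <= 1) ->
  exists g, exists2 r' : nat -> R, (forall i, 0 <= r' i <= 1) &
    comb x n (fun i => of_real s (r i) * a i) =
      g + of_real s (2^-1 ^+ k) *: comb x n (fun i => of_real s (r' i) * a i)
    /\ q g <= C * q (comb x n a).
Proof.
have [kappa kappa1 tri] := qnorm_triangle hq.
elim: k => [|k [C C0 IH]].
  exists 0 => // r n a r01; exists 0, r => //; split; last by rewrite qnorm0 mul0r.
  by rewrite expr0 of_real1 scale1r add0r.
exists (kappa * (K + C)) => [|r n a r01].
  by rewrite mulr_ge0 ?addr_ge0 ?(le_trans _ kappa1).
have [A [r' r'01 ->]] := comb_binary_step r01.
have [g [r'' r''01 [-> gC]]] := IH r' n a r'01.
exists (of_real s 2^-1 *: comb x n (fun i => \1_A i * a i) + of_real s 2^-1 *: g).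
exists r'' => //; split.
  by rewrite exprS of_realM -scalerA scalerDr addrA.
apply: le_trans (tri _ _) _; rewrite -mulrA ler_wpM2l ?(le_trans _ kappa1)//.
(* The two factors 1/2 are simply estimated by 1, which accounts for the constant kappa * (K +
   C). *)
rewrite !qnormZ_real ?invr_ge0// mulrDl.
have := hK A n a; have := qnorm_ge0 hq (comb x n (fun i => \1_A i * a i)).
have := qnorm_ge0 hq g; lra.
Qed.

Lemma comb_unit_bound : exists2 C : R, 0 <= C &
  forall (gamma : nat -> F) n a, (forall i, modulus (gamma i) <= 1) ->
  q (comb x n (fun i => gamma i * a i)) <= C * q (comb x n a).
Proof.
have [kappa kappa1 tri] := qnorm_triangle hq.
have k0 : 0 <= kappa by lra.
(* With N >= kappa an integer, k = N + 1 works, since N <= 2^N. *)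
have [k hk] : exists k, kappa * 2^-1 ^+ k <= 2^-1.
  have /ltW kN := Num.Theory.archi_boundP k0.
  exists (Num.bound kappa).+1.
  rewrite exprS mulrCA ler_piMr ?invr_ge0// exprVn ler_pdivrMr ?exprn_gt0// mul1r.
  apply: le_trans kN _; rewrite -natrX ler_nat; exact/ltnW/ltn_expl.
have [C C0 digits] := comb_binary_digits k.
have real_bound (r : nat -> R) n a : (forall i, 0 <= r i <= 1) ->
    q (comb x n (fun i => of_real s (r i) * a i)) <=
      2 * kappa * C * q (comb x n a).
  have [D DP] := comb_bounded n a; move=> r01.
  (* For fixed [n] and [a], the recursion runs over all sequences in [0,1]. One application of the
     triangle inequality leaves the remainder with the factor kappa * 2^-k <= 1/2, so theta = 1/2
     and the bound is twice the contribution of the digits. *)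
  have := @affine_recursion_bound R _ (fun r => forall i, 0 <= r i <= 1)
    (fun r => q (comb x n (fun i => of_real s (r i) * a i)))
    (kappa * C * q (comb x n a)) 2^-1 D.
  rewrite (_ : kappa * C * q (comb x n a) / (1 - 2^-1) =
     2 * kappa * C * q (comb x n a)); last by field.
  apply => //; first by apply/andP; split; lra.
  move=> r1 /(digits r1 n a)[g [r' r'01 [-> gC]]]; exists r' => //.
  apply: le_trans (tri _ _) _; rewrite qnormZ_real ?exprn_ge0 ?invr_ge0// mulrDr.
  rewrite lerD//; first by rewrite -mulrA ler_wpM2l.
  by rewrite mulrA ler_wpM2r// qnorm_ge0.
have [c c0 cP] := qnorm_sum (nparts s).
exists (c * (2 * kappa * C)) => [|gamma n a /(comb_parts x)].
  by rewrite !mulr_ge0.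
move=> [u [r [u1 r01 ->]]]; rewrite -mulrA; apply: cP => [|j _].
  by rewrite !mulr_ge0// qnorm_ge0.
by rewrite (qnormZ hq) u1 mul1r real_bound.
Qed.

Lemma comb_unit_pbound (p : R) : 0 < p ->
  (forall f g, q (f + g) `^ p <= q f `^ p + q g `^ p) ->
  forall (gamma : nat -> F) n a, (forall i, modulus (gamma i) <= 1) ->
  q (comb x n (fun i => gamma i * a i)) <= B_const s p * K * q (comb x n a).
Proof.
move=> p0 tri gamma n a gamma1.
set f := comb x n a.
have Kf0 : 0 <= K * q f by rewrite mulr_ge0// qnorm_ge0.
have p2 := powR2_gt1 p0.
have A0 : 0 <= A_const p :> R by exact: powR_ge0.
have Ap : A_const p `^ p = (2 `^ p - 1)^-1 :> R.
  by rewrite /A_const -powRrM mulNr mulVf ?gt_eqF// powR_inv1; lra.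
have half : 2^-1 `^ p = (2 `^ p)^-1 :> R.
  by rewrite -powR_inv1// -powRrM mulrC powRrM powR_inv1 ?powR_ge0.
have real_bound (r : nat -> R) : (forall i, 0 <= r i <= 1) ->
    q (comb x n (fun i => of_real s (r i) * a i)) `^ p <=
      (A_const p * (K * q f)) `^ p.
  have [D DP] := comb_bounded n a; move=> r01.
  have := @affine_recursion_bound R _ (fun r => forall i, 0 <= r i <= 1)
    (fun r => q (comb x n (fun i => of_real s (r i) * a i)) `^ p)
    ((2 `^ p)^-1 * (K * q f) `^ p) (2 `^ p)^-1 (D `^ p).
  (* Here a = 2^-p (K q(f))^p and theta = 2^-p, so a / (1 - theta) = (K q(f))^p / (2^p - 1), which
     is where A_p comes from. *)
  rewrite (_ : _ / (1 - (2 `^ p)^-1) = (A_const p * (K * q f)) `^ p); last first.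
    by rewrite (powRM _ A0 Kf0) Ap; field; apply/andP; split; rewrite gt_eqF//; lra.
  apply => //.
  - by rewrite invr_ge0 powR_ge0 invf_lt1//; lra.
  - move=> r1 /DP rD; apply: ge0_ler_powR => //; first exact: ltW.
      by rewrite nnegrE qnorm_ge0.
    by rewrite nnegrE; apply: le_trans rD; exact: qnorm_ge0.
  move=> r1 /comb_binary_step[A [r' r'01 ->]]; exists r' => //.
  apply: le_trans (tri _ _) _.
  rewrite !qnormZ_real ?invr_ge0// !powRM ?invr_ge0 ?qnorm_ge0// half.
  rewrite lerD2r ler_wpM2l ?invr_ge0 ?powR_ge0//.
  rewrite -powRM ?qnorm_ge0//; apply: ge0_ler_powR => //; first exact: ltW.
  - by rewrite nnegrE qnorm_ge0.
have psum m (v : nat -> X) : q (\sum_(0 <= k < m) v k) `^ p <=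
    \sum_(0 <= k < m) q (v k) `^ p.
  elim: m => [|m IH]; first by rewrite !big_geq// qnorm0 powR0// gt_eqF.
  by rewrite !big_nat_recr//=; apply: le_trans (tri _ _) _; rewrite lerD2r.
have BE : B_const s p = (nparts s)%:R `^ p^-1 * A_const p.
  by rewrite /B_const /nparts; case: s.
have Bp : (B_const s p * K * q f) `^ p =
    (nparts s)%:R * (A_const p * (K * q f)) `^ p.
  rewrite BE -!mulrA powRM ?powR_ge0 ?mulr_ge0 ?qnorm_ge0//.
  by rewrite -powRrM mulVf ?gt_eqF// powRr1 ?ler0n.
have B0 : 0 <= B_const s p * K * q f.
  by rewrite BE -mulrA !mulr_ge0 ?powR_ge0 ?qnorm_ge0.
(* As u -> u^p is strictly increasing on nonnegative reals, it suffices to compare p-th powers.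
   There the [nparts s] pieces add up, each contributing at most (A_p K q(f))^p, and the p-th root
   of their number turns A_p into B_p. *)
rewrite leNgt; apply/negP => /(gt0_ltr_powR p0).
rewrite !nnegrE B0 qnorm_ge0// => /(_ isT isT); apply/negP; rewrite -leNgt Bp.
have [u [r [u1 r01 ->]]] := comb_parts x gamma1.
apply: le_trans (psum _ _) _.
rewrite -[in X in _ <= X](subn0 (nparts s)) mulr_natl -sumr_const_nat.
apply: ler_sum => k _.
by rewrite (qnormZ hq) u1 mul1r real_bound.
Qed.

End QuasiNormBounds.

(** Both coefficient families are padded with zeros to the common length [maxn n m]. The resulting
    [d] is independent of [gamma], so it describes a linear combination in the span together with
    its image under every multiplier. *)
Lemma comb_lin (R : realType) (s : scalars)
    (X : PreUniformLmodule.type (scalar_field R s)) (x : nat -> X)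
    z n m (a b : nat -> scalar_field R s) : exists N d,
  comb x N d = z *: comb x n a + comb x m b /\ forall gamma,
  comb x N (fun i => gamma i * d i) =
    z *: comb x n (fun i => gamma i * a i) + comb x m (fun i => gamma i * b i).
Proof.
exists (maxn n m), (fun i => z * ((i < n)%:R * a i) + (i < m)%:R * b i).
rewrite (comb_widen x a (leq_maxl n m)) (comb_widen x b (leq_maxr n m)).
split=> [|gamma]; first by rewrite -combZ -combD.
rewrite (comb_widen x (fun i => gamma i * a i) (leq_maxl n m)).
rewrite (comb_widen x (fun i => gamma i * b i) (leq_maxr n m)).
by rewrite -combZ -combD; apply: eq_comb => i; ring.
Qed.

(** * Extension from the span to the whole space through the closure of the graph *)

Section Extension.
Variables (R : realType) (s : scalars).
Local Notation F := (scalar_field R s).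
Variables (X : PreUniformLmodule.type F) (q : X -> R) (x : nat -> X).
Hypothesis hX : quasi_banach q.
Let hq := qbanach_norm hX.

Lemma qnorm_nbhsP (f : X) (B : set X) : nbhs f B <->
  exists2 e : R, 0 < e & forall g, q (f - g) < e -> B g.
Proof.
rewrite -nbhs_entourageE /nbhs_ (qbanach_entourage hX); split.
  move=> [E [e /= e0 eE] EB]; exists e => // g fg; apply: EB.
  by rewrite /xsection /=; apply/mem_set/eE.
move=> [e e0 eB]; exists [set fg : X * X | q (fg.1 - fg.2) < e]; first by exists e.
by move=> g; rewrite /xsection /= => /set_mem /=; exact: eB.
Qed.

Lemma qnormB f g : q (f - g) = q (g - f).
Proof. by rewrite -(qnormN hq) opprB. Qed.

Hypothesis dense : closure (linear_span x) = setT.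

Lemma comb_dense f e : 0 < e -> exists n a, q (f - comb x n a) < e.
Proof.
move=> e0; have : closure (linear_span x) f by rewrite dense.
move=> /(_ [set g | q (f - g) < e])[]; first by apply/qnorm_nbhsP; exists e.
by move=> _ [[n [a ->]] /= h]; exists n, a.
Qed.

(** The closure in X * X of the graph of [M_gamma] on the span: one and the same combination
    approximates [f] while its image approximates [y]. As a relation it requires no choice of
    approximating sequences. *)
Definition in_graph_closure gamma f y := forall e, 0 < e -> exists n a,
  q (f - comb x n a) < e /\ q (y - comb x n (fun i => gamma i * a i)) < e.

Variables (C : R).
Hypothesis C0 : 0 <= C.

(** A quasi-norm need not be continuous, so the bound [C] may degrade in the limit. Passing from [y]
    to the image of a combination, and from that combination to [f], costs one kappa each. The
    constant precedes [gamma], as a bound for [K_u] requires. *)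
Lemma graph_closure_bound : exists2 c : R, 0 <= c &
  forall gamma, (forall n a,
    q (comb x n (fun i => gamma i * a i)) <= C * q (comb x n a)) ->
  forall f y, in_graph_closure gamma f y -> q y <= c * q f.
Proof.
have [kappa kappa1 tri] := qnorm_triangle hq.
exists (kappa * C * kappa) => [|gamma gammaC f y fy].
  by rewrite !mulr_ge0//; lra.
apply/ler_addgt0Pr => e e0.
(* The total factor on the two approximation errors; dividing [e] by it makes them add up to exactly
   [e]. *)
have D0 : 0 < kappa + kappa * C * kappa.
  by rewrite ltr_wpDr ?mulr_ge0//; lra.
have [n [a [fa ya]]] := fy _ (divr_gt0 e0 D0).
set d := e / _ in fa ya.
have -> : kappa * C * kappa * q f + e = kappa * (d + C * (kappa * (d + q f))).
  by rewrite /d; field; rewrite gt_eqF.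
rewrite -[y](subrK (comb x n (fun i => gamma i * a i))).
apply: le_trans (tri _ _) _; rewrite ler_wpM2l ?(le_trans _ kappa1)//.
rewrite lerD ?(ltW ya)//; apply: le_trans (gammaC _ _) _; rewrite ler_wpM2l//.
rewrite -[comb x n a](subrK f); apply: le_trans (tri _ _) _.
by rewrite ler_wpM2l ?lerD2r 1?qnormB ?ltW ?(lt_le_trans _ kappa1).
Qed.

Variables (gamma : nat -> F).
Hypothesis gammaC : forall n a,
  q (comb x n (fun i => gamma i * a i)) <= C * q (comb x n a).

Lemma graph_closure_comb n a :
  in_graph_closure gamma (comb x n a) (comb x n (fun i => gamma i * a i)).
Proof. by move=> e e0; exists n, a; rewrite !subrr (qnorm0 hq). Qed.

Lemma graph_closure_lin z f g y w : in_graph_closure gamma f y ->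
  in_graph_closure gamma g w -> in_graph_closure gamma (z *: f + g) (z *: y + w).
Proof.
have [kappa kappa1 tri] := qnorm_triangle hq.
move=> fy gw e e0; set M := kappa * (modulus z + 1).
have z0 := modulus_ge0 z.
have M0 : 0 < M by rewrite mulr_gt0; lra.
have d0 : 0 < e / M by rewrite divr_gt0.
have [n [a [fa ya]]] := fy _ d0; have [m [b [gb wb]]] := gw _ d0.
have [N [d [dE dE']]] := comb_lin x z n m a b; exists N, d.
have bound u v u' v' : q (u - u') < e / M -> q (v - v') < e / M ->
    q (z *: u + v - (z *: u' + v')) < e.
  move=> hu hv; rewrite opprD addrACA -scalerBr.
  apply: le_lt_trans (tri _ _) _; rewrite (qnormZ hq).
  have -> : e = kappa * (modulus z * (e / M) + e / M).
    by rewrite /M; field; apply/andP; split; rewrite gt_eqF//; lra.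
  rewrite ltr_pM2l ?(lt_le_trans _ kappa1)// ler_ltD//.
  by rewrite ler_wpM2l// ltW.
by rewrite dE dE'; split; exact: bound.
Qed.

(** The images of the combinations close to [f] generate a filter. It is proper by density and
    Cauchy by [gammaC], and completeness supplies its limit [y]. *)
Lemma graph_closure_total f : exists y, in_graph_closure gamma f y.
Proof.
have [kappa kappa1 tri] := qnorm_triangle hq.
pose N e := [set y | exists n a, q (f - comb x n a) < e /\
  y = comb x n (fun i => gamma i * a i)].
pose G := filter_from [set e : R | 0 < e] N.
have N_mono d e : d <= e -> N d `<=` N e.
  by move=> de _ [n [a [fa ->]]]; exists n, a; split => //; apply: lt_le_trans de.
have GF : ProperFilter G.
  apply: filter_from_proper.
    apply: filter_from_filter; first by exists 1 => /=.
    move=> d e /= d0 e0; exists (Num.min d e); first by rewrite /= lt_min d0.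
    by rewrite subsetI; split; apply: N_mono; rewrite ge_min lexx ?orbT.
  move=> e /= /(comb_dense f)[n [a fa]].
  by exists (comb x n (fun i => gamma i * a i)), n, a.
have Gcauchy : cauchy G.
  move=> E; rewrite (qbanach_entourage hX) => -[e /= e0 eE].
  (* Images of two combinations within d of [f] are at distance at most 2 C kappa d. The extra 1
     keeps the divisor positive when C = 0 and makes the final inequality strict. *)
  have M0 : 0 < C * kappa * 2 + 1 by rewrite ltr_wpDl ?mulr_ge0//; lra.
  have d0 := divr_gt0 e0 M0; set d := e / _ in d0.
  exists (N d, N d); first by split; exists d.
  move=> [_ _] /= [[n [a [fa ->]]] [m [b [fb ->]]]]; apply: eE => /=.
  have [k [c [cE cE']]] := comb_lin x (-1) m n b a.
  rewrite addrC -scaleN1r -cE'; apply: le_lt_trans (gammaC _ _) _.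
  have -> : e = C * (kappa * (d + d)) + d by rewrite /d; field; rewrite gt_eqF.
  apply: (@le_lt_trans _ _ (C * (kappa * (d + d)))); last by rewrite ltrDl.
  rewrite ler_wpM2l// cE scaleN1r addrC -[comb x n a](subrK f) -addrA.
  apply: le_trans (tri _ _) _; rewrite ler_wpM2l ?(le_trans _ kappa1)//.
  by rewrite qnormB lerD ?ltW.
have [y Gy] := qbanach_complete hX GF Gcauchy; exists y => e e0.
have [d /= d0 dN] : G [set w | q (y - w) < e].
  by apply: Gy; apply/qnorm_nbhsP; exists e.
(* The combination must be within [e] of [f], and also within [d], which forces its image to be
   within [e] of [y]. *)
have m0 : 0 < Num.min d e by rewrite lt_min d0.
have [n [a fa]] := comb_dense f m0; exists n, a; move: fa.
rewrite lt_min => /andP[fad fae]; split => //.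
by apply: dN; exists n, a.
Qed.

(** The graph closure is total and linear, and [graph_closure_bound] at 0 makes it single-valued,
    hence a bounded operator. That [T] lies in the graph closure is recorded so that its norm can be
    estimated later with different constants. *)
Lemma multiplier_extension : exists2 T : {linear X -> X}, multiplier x gamma T &
  forall f, in_graph_closure gamma f (T f).
Proof.
have [c c0 /(_ gamma gammaC) cP] := graph_closure_bound.
have uniq f y w : in_graph_closure gamma f y -> in_graph_closure gamma f w -> y = w.
  move=> fy fw; have := cP _ _ (graph_closure_lin (-1) fw fy).
  rewrite !scaleN1r addNr (qnorm0 hq) mulr0 addrC => qyw.
  by apply/subr0_eq/(qnorm_eq0 hq)/le_anti; rewrite qyw qnorm_ge0.
have /choice[T0 T0P] := graph_closure_total.
have T0lin : linear T0.
  by move=> z f g; apply: uniq (T0P _) _; exact: graph_closure_lin.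
pose T : {linear X -> X} :=
  HB.pack T0 (@GRing.isLinear.Build F X X *:%R T0 T0lin).
exists T => //; split; last first.
  by move=> n a; apply: uniq (T0P _) _; exact: graph_closure_comb.
move=> f B /qnorm_nbhsP[e e0 eB].
have M0 : 0 < c + 1 by lra.
apply/qnorm_nbhsP; exists (e / (c + 1)); first exact: divr_gt0.
move=> g fg; apply: eB; rewrite -linearB; apply: le_lt_trans (cP _ _ (T0P _)) _.
rewrite -(ltr_pM2l M0) [ltRHS]mulrC divfK ?gt_eqF// in fg.
apply: le_lt_trans fg; rewrite ler_wpM2r ?qnorm_ge0//; lra.
Qed.

End Extension.

(** * Multiplier norms and the constants [K_u] and [K_su] *)

Section MultiplierNorms.
Variables (R : realType) (s : scalars).
Local Notation F := (scalar_field R s).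
Variables (X : PreUniformLmodule.type F) (q : X -> R) (x : nat -> X).
Hypothesis hq : quasi_norm q.

Lemma multiplier_norm_ge0 gamma : (0 <= multiplier_norm q x gamma)%E.
Proof.
apply: le_ereal_inf_tmp => _ [T _ <-].
apply: le_trans (ereal_sup_ubound _); last first.
  by exists 0 => //=; rewrite (qnorm0 hq).
by rewrite lee_fin qnorm_ge0.
Qed.

Lemma multiplier_norm_well_defined gamma :
  (multiplier_norm q x gamma < +oo)%E -> well_defined x gamma.
Proof.
by move=> /ereal_inf_lt[_ [T hT _] _]; exists T.
Qed.

Lemma multiplier_norm_le gamma (T : {linear X -> X}) C : multiplier x gamma T ->
  (forall f, q f <= 1 -> q (T f) <= C) -> (multiplier_norm q x gamma <= C%:E)%E.
Proof.
move=> hT TC; apply: le_trans (ereal_inf_lbound _) _; first by exists T.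
by apply: ge_ereal_sup => _ [f /= f1 <-]; rewrite lee_fin TC.
Qed.

Lemma comb_le_multiplier_norm gamma K : (multiplier_norm q x gamma <= K%:E)%E ->
  forall n a, q (comb x n (fun i => gamma i * a i)) <= K * q (comb x n a).
Proof.
move=> hK n a; set f := comb x n a.
have [T [_ TP]] : well_defined x gamma.
  by apply: multiplier_norm_well_defined; apply: le_lt_trans hK (ltry _).
(* When q(f) = 0 no normalization is possible. Then f = 0, and the linear extension [T] shows that
   the image vanishes even if the coefficients do not. *)
have [f0|fN0] := eqVneq (q f) 0.
  rewrite f0 mulr0 -[comb x n _]TP -/(comb x n a) -/f (qnorm_eq0 hq f0) linear0.
  by rewrite (qnorm0 hq).
have f_gt0 : 0 < q f by rewrite lt_neqAle eq_sym fN0 qnorm_ge0.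
rewrite -ler_pdivrMr// -lee_fin; apply: le_trans hK.
(* All extensions agree on the span, so each of their norms is tested on the same normalized
   vector. *)
apply: le_ereal_inf_tmp => _ [T' [_ T'P] <-].
apply: ereal_sup_ubound; exists (of_real s (q f)^-1 *: f) => /=.
  by rewrite (qnormZ_real hq) ?invr_ge0 ?qnorm_ge0// mulVf.
rewrite linearZ/= T'P -/(comb x n _) (qnormZ_real hq) ?invr_ge0 ?qnorm_ge0//.
by rewrite mulrC.
Qed.

Lemma K_su_le_K_u : (K_su q x <= K_u q x)%E.
Proof.
apply: ge_ereal_sup => _ [A _ <-]; apply: ereal_sup_ubound; exists (\1_A) => //=.
move=> n; rewrite indicE -of_real_bool modulus_of_real.
by case: (n \in A); rewrite ?normr1 ?normr0.
Qed.

Lemma K_su_ge0 : (0 <= K_su q x)%E.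
Proof.
apply: le_trans (multiplier_norm_ge0 (\1_set0)) _.
by apply: ereal_sup_ubound; exists set0.
Qed.

Lemma K_su_comb : (K_su q x < +oo)%E -> forall (A : set nat) n a,
  q (comb x n (fun i => \1_A i * a i)) <= fine (K_su q x) * q (comb x n a).
Proof.
move=> Koo A; apply: comb_le_multiplier_norm.
rewrite fineK ?ge0_fin_numE ?K_su_ge0//.
by apply: ereal_sup_ubound; exists A.
Qed.

Lemma lattice_suppression :
  lattice_unconditional q x -> suppression_unconditional q x.
Proof.
move=> [wd Koo]; split; last exact: le_lt_trans K_su_le_K_u Koo.
move=> A; apply: wd; exists 1 => n; rewrite indicE -of_real_bool modulus_of_real.
by case: (n \in A); rewrite ?normr1 ?normr0.
Qed.

End MultiplierNorms.

(** * The equivalence and the comparison of the constants *)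

Section Proposition.
Variables (R : realType) (s : scalars).
Local Notation F := (scalar_field R s).
Variables (X : PreUniformLmodule.type F) (q : X -> R) (x : nat -> X).
Hypotheses (hX : quasi_banach q) (dense : closure (linear_span x) = setT).
Let hq := qbanach_norm hX.

(** Finiteness of [K_su] carries the well-definedness of every [S_A], since the norm of a multiplier
    that is not well-defined is +oo. *)
Lemma suppression_lattice : (K_su q x < +oo)%E -> lattice_unconditional q x.
Proof.
move=> Koo; have K0 := fine_ge0 (K_su_ge0 x hq).
have [C C0 CP] := comb_unit_bound hq K0 (K_su_comb hq Koo).
split=> [gamma [M gammaM]|].
  (* A bound that is certainly positive, so that [gamma] can be divided by it and the case of
     modulus at most 1 applies. *)
  pose M1 := Num.max M 1.
  have M1_gt0 : 0 < M1 by rewrite lt_max ltr01 orbT.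
  have bound n a : q (comb x n (fun i => gamma i * a i)) <=
      M1 * C * q (comb x n a).
    have unit i : modulus (of_real s M1^-1 * gamma i) <= 1.
      rewrite modulusM modulus_of_real ger0_norm ?invr_ge0 ?(ltW M1_gt0)//.
      by rewrite ler_pdivrMl// mulr1 le_max gammaM.
    have := CP _ n a unit.
    under eq_comb do rewrite -mulrA.
    rewrite combZ (qnormZ_real hq) ?invr_ge0 ?(ltW M1_gt0)//.
    by rewrite ler_pdivrMl// mulrA.
  have M1C : 0 <= M1 * C by rewrite mulr_ge0// ltW.
  by have [T TP _] := multiplier_extension hX dense M1C bound; exists T.
have [c c0 cP] := graph_closure_bound x hX C0.
apply: (@le_lt_trans _ _ c%:E); last exact: ltry.
apply: ge_ereal_sup => _ [gamma /= gamma1 <-].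
have bound n a := CP gamma n a gamma1.
have [T TP graphT] := multiplier_extension hX dense C0 bound.
apply: multiplier_norm_le TP _ => f f1.
by apply: le_trans (cP _ bound _ _ (graphT f)) _; rewrite ler_piMr.
Qed.

(** The p-th power of [q] is subadditive, so approximation errors enter additively and the constant
    [C] survives the limit unchanged. The loss of kappa^2 in [graph_closure_bound] would spoil the
    constant B_p. *)
Lemma graph_closure_pbound (gamma : nat -> F) (p C : R) f y : 0 < p -> 0 <= C ->
  (forall f g, q (f + g) `^ p <= q f `^ p + q g `^ p) ->
  (forall n a, q (comb x n (fun i => gamma i * a i)) <= C * q (comb x n a)) ->
  in_graph_closure q x gamma f y -> q y <= C * q f.
Proof.
move=> p0 C0 tri bound near.
have q0 g : 0 <= q g := qnorm_ge0 hq g.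
have mono (u v : R) : 0 <= u -> u <= v -> u `^ p <= v `^ p.
  move=> u0 uv; apply: ge0_ler_powR; rewrite ?nnegrE ?(ltW p0) ?u0//.
  exact: le_trans uv.
rewrite leNgt; apply/negP => /(gt0_ltr_powR p0).
rewrite !nnegrE q0 mulr_ge0// => /(_ isT isT); apply/negP; rewrite -leNgt.
rewrite powRM//; apply/ler_addgt0Pr => e e0.
have Cp0 : 0 <= C `^ p := powR_ge0 _ _.
have D0 : 0 < 1 + C `^ p by lra.
have d0 := divr_gt0 e0 D0; set d := e / _ in d0.
(* Closeness d^(1/p) makes the p-th power of each error less than d; the two contribute d and C^p d,
   whose sum is [e]. *)
have [n [a [fa ya]]] := near _ (powR_gt0 p^-1 d0).
have dE : (d `^ p^-1) `^ p = d by rewrite -powRrM mulVf ?gt_eqF// powRr1 ?ltW.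
have -> : C `^ p * q f `^ p + e = d + C `^ p * (d + q f `^ p).
  by rewrite /d; field; rewrite gt_eqF.
rewrite -[y](subrK (comb x n (fun i => gamma i * a i))).
apply: le_trans (tri _ _) _; rewrite lerD//.
  by rewrite -dE; apply: mono => //; exact: ltW.
apply: le_trans (mono _ _ (q0 _) (bound _ _)) _.
rewrite powRM// ler_wpM2l//.
rewrite -[comb x n a](subrK f); apply: le_trans (tri _ _) _.
by rewrite lerD2r -dE; apply: mono => //; rewrite (qnormB hX) ltW.
Qed.

Lemma K_u_le p : 0 < p ->
  (forall f g, q (f + g) `^ p <= q f `^ p + q g `^ p) ->
  (K_u q x <= (B_const s p)%:E * K_su q x)%E.
Proof.
move=> p0 tri.
have B0 : 0 < B_const s p :> R.
  have A0 : 0 < A_const p :> R.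
    by apply: powR_gt0; rewrite subr_gt0 powR2_gt1.
  by rewrite /B_const; case: s; rewrite mulr_gt0// powR_gt0.
(* If [K_su] is infinite, the right-hand side is +oo because B_p is strictly positive. *)
have [Koo|] := ltP (K_su q x) +oo%E; last first.
  by rewrite leye_eq => /eqP ->; rewrite gt0_muley ?lte_fin// leey.
have K0 := fine_ge0 (K_su_ge0 x hq).
have bound := comb_unit_pbound hq K0 (K_su_comb hq Koo) p0 tri.
rewrite -[K_su q x]fineK ?ge0_fin_numE ?K_su_ge0// -EFinM.
apply: ge_ereal_sup => _ [gamma /= gamma1 <-].
have BK0 : 0 <= B_const s p * fine (K_su q x) by rewrite mulr_ge0// ltW.
have bound1 n a := bound gamma n a gamma1.
have [T TP graphT] := multiplier_extension hX dense BK0 bound1.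
apply: multiplier_norm_le TP _ => f f1.
apply: le_trans (graph_closure_pbound p0 BK0 tri bound1 (graphT f)) _.
by rewrite ler_piMr.
Qed.

End Proposition.

Theorem proposition1p7 (R : realType) (s : scalars)
    (X : PreUniformLmodule.type (scalar_field R s)) (q : X -> R)
    (x : nat -> X) (hX : quasi_banach q) (hx : is_basis x) :
  [/\ suppression_unconditional q x <-> lattice_unconditional q x,
      (K_su q x <= K_u q x)%E
    & forall p : R, 0 < p <= 1 -> p_banach q p ->
        (K_u q x <= (B_const s p)%:E * K_su q x)%E].
Proof.
have [dense _] := hx; split.
- split=> [[_ Koo]|]; first exact: suppression_lattice.
  exact: lattice_suppression.
- exact: K_su_le_K_u.
- by move=> p /andP[p0 _] [_ tri]; exact: K_u_le.
Qed.
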